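(* Let $n\ge 2$, $\mathfrak g=\mathfrak{sp}(2n,\mathbb C)$, and let $\lambda=(\lambda_1,\dots,\lambda_n)\in\mathbb C^n$. Let $(\Phi_{\lambda,a^{(0)},b^{(0)}},V)$ be the specialized Schnizer module of $U_\varepsilon(\mathfrak{sp}(2n,\mathbb C))$ defined in the context. Then a vector $u\in V$ satisfies $e_iu=0$ for all $i\in\{1,\dots,n\}$ if and only if $u\in\mathbb C\,u(0)$, where $u(0)=u(0,\dots,0)\in V$ is the basis vector with all indices equal to $0$.
   Context: **Quantum algebra.** $l>3$ is an odd integer, $\varepsilon\in\mathbb C$ a primitive $l$-th root of unity, $I=\{1,\dots,n\}$, $(a_{ij})$ is the Cartan matrix of $\mathfrak{sp}(2n,\mathbb C)$ with $d=(d_1,\dots,d_n)=(1,\dots,1,2)$, $d_ia_{ij}=d_ja_{ji}$ (so $\alpha_n$ is the long simple root), $\varepsilon_i=\varepsilon^{d_i}$, $[k]_{\varepsilon_i}=\frac{\varepsilon_i^k-\varepsilon_i^{-k}}{\varepsilon_i-\varepsilon_i^{-1}}$, $[k]_{\varepsilon_i}!=[k]_{\varepsilon_i}\cdots[1]_{\varepsilon_i}$. $U_\varepsilon=U_\varepsilon(\mathfrak g)$ is the associative $\mathbb C$-algebra with generators $e_i,f_i,t_i^{\pm1}$ ($i\in I$) and relations $t_it_i^{-1}=t_i^{-1}t_i=1$, $t_it_j=t_jt_i$, $t_ie_jt_i^{-1}=\varepsilon_i^{a_{ij}}e_j$, $t_if_jt_i^{-1}=\varepsilon_i^{-a_{ij}}f_j$,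 $e_if_j-f_je_i=\delta_{ij}\frac{t_i-t_i^{-1}}{\varepsilon_i-\varepsilon_i^{-1}}$, and for $i\ne j$, $\sum_{k=0}^{1-a_{ij}}(-1)^ke_i^{(k)}e_je_i^{(1-a_{ij}-k)}=0=\sum_{k=0}^{1-a_{ij}}(-1)^kf_i^{(k)}f_jf_i^{(1-a_{ij}-k)}$, where $e_i^{(k)}=e_i^k/[k]_{\varepsilon_i}!$, $f_i^{(k)}=f_i^k/[k]_{\varepsilon_i}!$. **The space $V$ and operators.** $V=(\mathbb C^l)^{\otimes n^2}$ has basis $u(m)$, $m=(m_{ij})_{1\le i,j\le n}$, $0\le m_{ij}\le l-1$; indices $m_{ij}$ are read modulo $l$. Put $b_{ij}=1-i+j$ for $i\le j$ and $b_{ij}=2n+2-i-j$ for $i>j$. Let $\epsilon_{ij}$ be the unit index vector at $(i,j)$. Define invertible operators $x_{i,j}u(m)=u(m-\epsilon_{ij})$ and $z_{i,j}u(m)=\varepsilon^{m_{ij}+b_{ij}}u(m)$ (this is the specialization $a^{(0)}=(1)_{i,j}$, $b^{(0)}=(\varepsilon^{b_{ij}})_{i,j}$ of the parameters). For an invertible operator $h$ and $d\ne0$ put $\{h\}_{\varepsilon^d}=\frac{h-h^{-1}}{\varepsilon^d-\varepsilon^{-d}}$, $\{h\}=\{h\}_\varepsilon$. For $c\in\mathbb C$, $\varepsilon^c=\exp(c\log\varepsilon)$ for a fixed choice of $\log\varepsilon$. Empty products are $1$, empty sums are $0$. **The module (Schnizer).** The following operators define a $U_\varepsilon$-module structure $\Phi_{\lambda,a^{(0)},b^{(0)}}$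 on $V$: $e_1=F_{1,1}$; $e_j=(\prod_{k=1}^{j-1}D_{k,j})F_{j,j}+\sum_{q=1}^{j-1}(\prod_{p=1}^{q-1}D_{p,j})C_{q,j}$ ($2\le j\le n$); $t_j=T_{1,j}^{-1}$ ($1\le j\le n$); $f_1=E_{1,1}$; $f_j=E_{j,j}+\sum_{i=1}^{j-1}B_{i,j}$ ($2\le j\le n$), where $C_{i,j}=\{z_{i,j}^{-1}z_{i,j-1}\}x_{i,j}+\{z_{j,i}^{-1}z_{j+1,i}\}x_{i,j}x_{j,i}x_{i,j-1}^{-1}$ ($1\le i<j\le n-1$); $C_{i,n}=\{z_{i,n}^2z_{n,i}^{-2}\}_{\varepsilon^2}x_{i,n-1}^{-2}x_{i,n}x_{n,i}^2+\{z_{i,n-1}z_{n,i}^{-1}\}x_{i,n-1}^{-1}x_{i,n}x_{n,i}+\{z_{i,n-1}^2z_{i,n}^{-2}\}_{\varepsilon^2}x_{i,n}$ ($1\le i<n$); $D_{i,j}=x_{i,j-1}^{-1}x_{i,j}x_{j+1,i}^{-1}x_{j,i}$ ($1\le i<j\le n-1$), $D_{i,n}=x_{i,n-1}^{-2}x_{n,i}^2$ ($1\le i<n$); $F_{j,j}=\{z_{j,j}^{-1}\}x_{j,j}$ ($1\le j\le n-1$), $F_{n,n}=\{z_{n,n}^{-2}\}_{\varepsilon^2}x_{n,n}$; $T_{i,j}=(\prod_{k=i}^{j-1}A_{k,j})T_{j,j}$ ($1\le i<j\le n$); $A_{i,j}=z_{i,j-1}^{-1}z_{i,j}^2z_{i,j+1}^{-1}z_{j+2,i}^{-1}z_{j+1,i}^2z_{j,i}^{-1}$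 ($1\le i<j\le n-2$), $A_{i,n-1}=z_{i,n-2}^{-1}z_{i,n-1}^2z_{i,n}^{-2}z_{n,i}^2z_{n-1,i}^{-1}$ ($1\le i<n-1$), $A_{i,n}=z_{i,n-1}^{-2}z_{i,n}^4z_{n,i}^{-2}$ ($1\le i<n$); $T_{j,j}=z_{j,j}^2z_{j,j+1}^{-1}z_{j+2,j}^{-1}z_{j+1,j}^2z_{j+1,j+1}^{-1}z_{j+2,j+1}^{-1}\varepsilon^{\lambda_j}$ ($1\le j\le n-2$), $T_{n-1,n-1}=z_{n-1,n-1}^2z_{n-1,n}^{-2}z_{n,n-1}^2z_{n,n}^{-2}\varepsilon^{\lambda_{n-1}}$, $T_{n,n}=z_{n,n}^4\varepsilon^{\lambda_n}$; $B_{i,j}=\{z_{i,j+1}^{-1}z_{j+2,i}^{-1}z_{j+1,i}^2z_{j,i}^{-1}z_{i,j}T_{i+1,j}\}x_{i,j}^{-1}+\{z_{j,i}^{-1}z_{j+1,i}T_{i+1,j}\}x_{j+1,i}^{-1}$ ($1\le i<j\le n-2$); $B_{i,n-1}=\{z_{i,n}^{-2}z_{i,n-1}z_{n,i}^2z_{n-1,i}^{-1}T_{i+1,n-1}\}x_{i,n-1}^{-1}+\{z_{n-1,i}^{-1}z_{n,i}T_{i+1,n-1}\}x_{n,i}^{-1}$ ($1\le i<n-1$); $B_{i,n}=\{z_{i,n}^2z_{n,i}^{-2}T_{i+1,n}\}_{\varepsilon^2}x_{i,n}^{-1}$ ($1\le i<n$); $E_{j,j}=\{z_{j,j}z_{j,j+1}^{-1}z_{j+2,j}^{-1}z_{j+1,j}^2z_{j+1,j+1}^{-1}z_{j+2,j+1}^{-1}\varepsilon^{\lambda_j}\}x_{j,j}^{-1}+\{z_{j+1,j}z_{j+1,j+1}^{-1}z_{j+2,j+1}^{-1}\varepsilon^{\lambda_j}\}x_{j+1,j}^{-1}$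 ($1\le j\le n-2$); $E_{n-1,n-1}=\{z_{n-1,n-1}z_{n-1,n}^{-2}z_{n,n-1}^2z_{n,n}^{-2}\varepsilon^{\lambda_{n-1}}\}x_{n-1,n-1}^{-1}+\{z_{n,n-1}z_{n,n}^{-2}\varepsilon^{\lambda_{n-1}}\}x_{n,n-1}^{-1}$; $E_{n,n}=\{z_{n,n}^2\varepsilon^{\lambda_n}\}_{\varepsilon^2}x_{n,n}^{-1}$. *)

(* Defs.v *)
From HB Require Import structures.
From mathcomp Require Import all_boot all_order all_algebra.
From mathcomp.real_closed Require Import complex.
From mathcomp Require Import reals sequences exp trigo.

Set Implicit Arguments.
Unset Strict Implicit.
Unset Printing Implicit Defensive.

Import Order.TTheory GRing.Theory Num.Theory.
Local Open Scope ring_scope.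

(* exp(x + iy) = e^x (cos y + i sin y). *)
Definition cexp (R : realType) (w : R[i]) : R[i] :=
  (expR (complex.Re w) * cos (complex.Im w)
     +i* (expR (complex.Re w) * sin (complex.Im w)))%C.

(* Families over 'I_n are read with the 1-based index k, 1 <= k <= n, of the
   mathematical text; the default value is never reached by the formulas. *)
Definition at1 (T : Type) (x0 : T) (n : nat) (f : 'I_n -> T) (k : nat) : T :=
  oapp f x0 (insub k.-1).

Section Operators.
Variables (K : fieldType) (W : vectType K).

(* Integer powers of an operator; meaningful for k < 0 when f is invertible. *)
Definition lpow (f : 'End(W)) (k : int) : 'End(W) :=
  match k with
  | Posz p => iter p (comp_lfun f) \1%VF
  | Negz p => iter p.+1 (comp_lfun (f^-1)%VF) \1%VF
  end.

(* F m o F (m+1) o ... o F (n-1), the identity if n <= m. *)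
Definition lprod (m n : nat) (F : nat -> 'End(W)) : 'End(W) :=
  \big[@comp_lfun K W W W / \1%VF]_(m <= k < n) F k.

(* {h}_q = (h - h^-1) / (q - q^-1) *)
Definition qbrace (q : K) (h : 'End(W)) : 'End(W) :=
  (q - q^-1)^-1 *: (h - (h^-1)%VF).

End Operators.

Declare Scope qop_scope.
Delimit Scope qop_scope with qop.
Notation "f * g" := (comp_lfun f%qop g%qop) : qop_scope.
Notation "f + g" := (GRing.add f%qop g%qop) : qop_scope.
Notation "f - g" := (GRing.add f%qop (GRing.opp g%qop)) : qop_scope.
Notation "a *: f" := (GRing.scale a%R f%qop) : qop_scope.
Notation "f ^^ k" := (lpow f%qop k%Z) (at level 30) : qop_scope.

Section QuantumAlgebra.
Variables (K : fieldType) (eps : K) (n : nat).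

(* Node i : 'I_n of the Dynkin diagram is the node i.+1 of {1, ..., n};
   the last one is the long simple root. *)
Definition dC (i : 'I_n) : nat := if i.+1 == n then 2 else 1.

Definition cartanC (i j : 'I_n) : int :=
  if i == j then 2
  else if (i.+1 == j :> nat) || (j.+1 == i :> nat) then
    (if j.+1 == n then - 2 else - 1)
  else 0.

Definition epsC (i : 'I_n) : K := eps ^+ dC i.

Definition qnum (q : K) (k : nat) : K := (q ^+ k - q ^- k) / (q - q^-1).

Definition qfact (q : K) (k : nat) : K := \prod_(1 <= s < k.+1) qnum q s.

Inductive Ueps_gen :=
  | Ue of 'I_n | Uf of 'I_n | Ut of 'I_n | Utinv of 'I_n.

Section Module.
Variables (W : vectType K) (Phi : Ueps_gen -> 'End(W)).
Local Open Scope qop_scope.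

Definition qdivpow (i : 'I_n) (g : 'End(W)) (k : nat) : 'End(W) :=
  (qfact (epsC i) k)^-1 *: (g ^^ k).

Definition qSerre (g : 'I_n -> 'End(W)) (i j : 'I_n) : 'End(W) :=
  let N := absz (1 - cartanC i j)%R in
  \sum_(k < N.+1)
    (-1) ^+ k *: (qdivpow i (g i) k * g j * qdivpow i (g i) (N - k))%qop.

(* The defining relations of U_eps(sp(2n)): a U_eps-module structure on W is
   an assignment of operators to the generators satisfying them. Schnizer's
   theorem is that the assignment [schnizer] below does. *)
Definition is_Ueps_module : Prop :=
  let e i := Phi (Ue i) in let f i := Phi (Uf i) in
  let t i := Phi (Ut i) in let t' i := Phi (Utinv i) in
  [/\ forall i, t i * t' i = \1%VF /\ t' i * t i = \1%VF,
      forall i j, t i * t j = t j * t i,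
      forall i j, t i * e j * t' i = (epsC i ^ cartanC i j) *: e j /\
                  t i * f j * t' i = (epsC i ^ (- cartanC i j)) *: f j,
      forall i j, e i * f j - f j * e i =
        (if i == j then (epsC i - (epsC i)^-1)^-1 *: (t i - t' i) else 0)
    & forall i j : 'I_n, i != j -> qSerre e i j = 0 /\ qSerre f i j = 0].

End Module.
End QuantumAlgebra.

Section SchnizerModule.
Variables (K : fieldType) (l n : nat).

Definition mindex : finType := 'M['Z_l]_n.

(* V = (C^l)^{(x) n^2}, as the free module on the index matrices m. *)
Definition Vspace : vectType K := {ffun mindex -> K^o}.

Definition ubasis (m : mindex) : Vspace := [ffun m' => (m' == m)%:R].

(* The linear map sending u(m) to g m. *)
Definition linext_fun (g : mindex -> Vspace) (v : Vspace) : Vspace :=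
  \sum_(m : mindex) (v m : K) *: g m.

Fact linext_fun_is_linear g : linear (linext_fun g).
Proof.
move=> a u v; rewrite /linext_fun scaler_sumr -big_split /=.
by apply: eq_bigr => m _; rewrite !ffunE scalerDl scalerA.
Qed.

HB.instance Definition _ g :=
  GRing.isLinear.Build K Vspace Vspace _ (linext_fun g)
    (linext_fun_is_linear g).

Definition linext (g : mindex -> Vspace) : 'End(Vspace) :=
  linfun (linext_fun g).

Lemma linextE g m : linext g (ubasis m) = g m.
Proof.
rewrite lfunE /= /linext_fun (bigD1 m) //= ffunE eqxx scale1r big1 ?addr0 //.
by move=> m' /negPf m'm; rewrite ffunE m'm scale0r.
Qed.

(* In all the operators below i and j range over 1, ..., n. *)
Definition mentry (m : 'M['Z_l]_n) (i j : nat) : nat :=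
  at1 0 (fun a => at1 0 (m a) j) i.

Definition munit (i j : nat) : 'M['Z_l]_n :=
  \matrix_(a, b) ((a.+1 == i) && (b.+1 == j))%:R.

(* Both branches are positive for 1 <= i, j <= n: no truncation occurs. *)
Definition bexp (i j : nat) : nat :=
  if (i <= j)%N then (1 + j - i)%N else (2 * n + 2 - i - j)%N.

(* [eps] is the root of unity and [elam j] stands for eps^{lambda_j}. *)
Variables (eps : K) (elam : nat -> K).

Definition xop (i j : nat) : 'End(Vspace) :=
  linext (fun m => ubasis ((m : 'M['Z_l]_n) - munit i j)%R).

Definition zop (i j : nat) : 'End(Vspace) :=
  linext (fun m => eps ^+ (mentry m i j + bexp i j) *: ubasis m).

Local Open Scope qop_scope.
Local Notation x := xop.
Local Notation z := zop.
Local Notation br1 := (qbrace eps).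
Local Notation br2 := (qbrace (eps ^+ 2)).

Definition opC (i j : nat) : 'End(Vspace) :=
  if j == n then
    (br2 (z i n ^^ 2 * z n i ^^ (-2))
       * x i n.-1 ^^ (-2) * x i n * x n i ^^ 2
     + br1 (z i n.-1 * z n i ^^ (-1)) * x i n.-1 ^^ (-1) * x i n * x n i
     + br2 (z i n.-1 ^^ 2 * z i n ^^ (-2)) * x i n)
  else
    (br1 (z i j ^^ (-1) * z i j.-1) * x i j
     + br1 (z j i ^^ (-1) * z j.+1 i) * x i j * x j i * x i j.-1 ^^ (-1)).

Definition opD (i j : nat) : 'End(Vspace) :=
  if j == n then x i n.-1 ^^ (-2) * x n i ^^ 2
  else x i j.-1 ^^ (-1) * x i j * x j.+1 i ^^ (-1) * x j i.

Definition opF (j : nat) : 'End(Vspace) :=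
  if j == n then br2 (z n n ^^ (-2)) * x n n else br1 (z j j ^^ (-1)) * x j j.

Definition opA (i j : nat) : 'End(Vspace) :=
  if j == n then z i n.-1 ^^ (-2) * z i n ^^ 4 * z n i ^^ (-2)
  else if j == n.-1 then
    z i (n - 2) ^^ (-1) * z i n.-1 ^^ 2 * z i n ^^ (-2) * z n i ^^ 2
      * z n.-1 i ^^ (-1)
  else
    z i j.-1 ^^ (-1) * z i j ^^ 2 * z i j.+1 ^^ (-1) * z j.+2 i ^^ (-1)
      * z j.+1 i ^^ 2 * z j i ^^ (-1).

Definition opTdiag (j : nat) : 'End(Vspace) :=
  if j == n then elam n *: (z n n ^^ 4)
  else if j == n.-1 then
    elam n.-1 *: (z n.-1 n.-1 ^^ 2 * z n.-1 n ^^ (-2) * z n n.-1 ^^ 2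
                    * z n n ^^ (-2))
  else
    elam j *: (z j j ^^ 2 * z j j.+1 ^^ (-1) * z j.+2 j ^^ (-1)
                 * z j.+1 j ^^ 2 * z j.+1 j.+1 ^^ (-1) * z j.+2 j.+1 ^^ (-1)).

Definition opT (i j : nat) : 'End(Vspace) :=
  lprod i j (fun k => opA k j) * opTdiag j.

Definition opB (i j : nat) : 'End(Vspace) :=
  if j == n then
    br2 (z i n ^^ 2 * z n i ^^ (-2) * opT i.+1 n) * x i n ^^ (-1)
  else if j == n.-1 then
    br1 (z i n ^^ (-2) * z i n.-1 * z n i ^^ 2 * z n.-1 i ^^ (-1)
           * opT i.+1 n.-1) * x i n.-1 ^^ (-1)
    + br1 (z n.-1 i ^^ (-1) * z n i * opT i.+1 n.-1) * x n i ^^ (-1)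
  else
    br1 (z i j.+1 ^^ (-1) * z j.+2 i ^^ (-1) * z j.+1 i ^^ 2 * z j i ^^ (-1)
           * z i j * opT i.+1 j) * x i j ^^ (-1)
    + br1 (z j i ^^ (-1) * z j.+1 i * opT i.+1 j) * x j.+1 i ^^ (-1).

Definition opE (j : nat) : 'End(Vspace) :=
  if j == n then br2 (elam n *: (z n n ^^ 2)) * x n n ^^ (-1)
  else if j == n.-1 then
    br1 (elam n.-1 *: (z n.-1 n.-1 * z n.-1 n ^^ (-2) * z n n.-1 ^^ 2
                         * z n n ^^ (-2))) * x n.-1 n.-1 ^^ (-1)
    + br1 (elam n.-1 *: (z n n.-1 * z n n ^^ (-2))) * x n n.-1 ^^ (-1)
  else
    br1 (elam j *: (z j j * z j j.+1 ^^ (-1) * z j.+2 j ^^ (-1)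
                      * z j.+1 j ^^ 2 * z j.+1 j.+1 ^^ (-1)
                      * z j.+2 j.+1 ^^ (-1))) * x j j ^^ (-1)
    + br1 (elam j *: (z j.+1 j * z j.+1 j.+1 ^^ (-1) * z j.+2 j.+1 ^^ (-1)))
        * x j.+1 j ^^ (-1).

(* For j = 1 the product and the sums are empty: e_1 = F_{1,1}, f_1 = E_{1,1}. *)
Definition op_e (j : nat) : 'End(Vspace) :=
  lprod 1 j (fun k => opD k j) * opF j
  + \sum_(1 <= q < j) (lprod 1 q (fun p => opD p j) * opC q j)%qop.

Definition op_f (j : nat) : 'End(Vspace) :=
  opE j + \sum_(1 <= i < j) opB i j.

End SchnizerModule.

(* The module Phi_{lambda, a^(0), b^(0)} on V; [logeps] is the chosen value of
   log eps, used to define eps^c = exp (c log eps). *)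
Definition schnizer (R : realType) (l n : nat) (eps logeps : R[i])
    (lam : 'rV[R[i]]_n) (g : Ueps_gen n) : 'End(Vspace R[i] l n) :=
  let elam j := cexp (at1 0 (lam 0) j * logeps) in
  match g with
  | Ue i => op_e l n eps i.+1
  | Uf i => op_f l n eps elam i.+1
  | Ut i => ((opT l n eps elam 1 i.+1)^-1)%VF
  | Utinv i => opT l n eps elam 1 i.+1
  end.

(* Main.v *)
Require Import Defs.
From mathcomp Require Import all_boot all_order all_algebra.
From mathcomp.real_closed Require Import complex.
From mathcomp Require Import reals.
From mathcomp Require Import zify ring.

Set Implicit Arguments.
Unset Strict Implicit.
Unset Printing Implicit Defensive.

Import GRing.Theory.
Local Open Scope ring_scope.

(** Every e_j is a sum of weighted shifts of the index matrix m, and peeling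
    off the smallest index k exhibits the recursion behind Schnizer's formulas:
    if e_j^(k) collects the part of e_j that involves the rows and columns of
    index at least k only, then e_j^(j) = F_{j,j} and
      e_j^(k) = C_{k,j} + D_{k,j} e_j^(k+1),
    where D_{k,j} is a bare shift ([e_from_rec]); moreover e_j = e_j^(1), so the
    e_j^(k) are the operators of the same shape for sp(2(n-k+1)).

    With b_{i,j} chosen as here, all constants in the weights cancel: the
    weight of each term, at the source index m, is a q-integer of a plain
    difference of entries of m ([opF_shift], [opC_short_shift],
    [opC_long_shift]).  All these differences vanish at m = 0, which gives
    e_j u(0) = 0.  As l is odd, a q-integer vanishes only at 0 ([qint_eq0]), so
    a vanishing weight forces an equality of entries.

    For the converse let u be killed by all e_j^(k), j >= k.  A vector is
    handled through its support, the set of m with a nonzero coefficient.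
    - Row k ([row_confined]): F_{k,k} u = 0 gives m_{k,k} = 0 on the support.
      If m_{k,j-1} = 0 on the support, then in e_j^(k) u = 0 only the first
      term of C_{k,j} leaves that entry at 0; the other terms move it to 1 or
      2, and these are nonzero modulo l > 3.  Hence that term vanishes by
      itself, and so m_{k,j} = m_{k,j-1} = 0.
    - Column k ([col_confined]): the middle term of C_{k,n} is the only one
      that moves m_{k,n-1} to 1, so it vanishes too and m_{n,k} = m_{k,n-1} = 0.
      Descending on j, the entry m_{j+1,k} = 0 separates C_{k,j} from
      D_{k,j} e_j^(k+1), and gives m_{j,k} = m_{j+1,k} = 0.
    - What is left of e_j^(k) u = 0 is D_{k,j} e_j^(k+1) u = 0, and D_{k,j} is
      invertible, so u is killed by all e_j^(k+1).
    Induction on k makes all entries vanish on the support ([lines_confined]),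
    so u is a multiple of u(0).  The separation is legitimate because
    e_j^(k+1) leaves row k and column k unchanged ([e_from_confined]). *)

Lemma lfun_inv_unique (K : fieldType) (W : vectType K) (f g : 'End(W)) :
  (f \o g)%VF = \1%VF -> (g \o f)%VF = \1%VF -> (f^-1)%VF = g.
Proof.
move=> fg gf.
have f0 : lker f == 0%VS.
  apply/lker0P => x y /(congr1 g); rewrite -!comp_lfunE gf.
  by rewrite !id_lfunE.
by rewrite -[LHS]comp_lfun1r -fg comp_lfunA lker0_compVf // comp_lfun1l.
Qed.

(** * The character of the cyclic group and q-integers *)

Section Kernel.
Variables (K : fieldType) (l n : nat) (eps : K).
Hypotheses (l_gt3 : (3 < l)%N) (l_odd : odd l) (eps_l : l.-primitive_root eps).

Local Notation V := (Vspace K l n).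
Local Notation M := 'M['Z_l]_n.

(** Reading exponents of eps in 'Z_l turns every weight below into the value
    of an additive character at a linear expression in the entries. *)
Definition chi (a : 'Z_l) : K := eps ^+ a.

Lemma chi_nat k : chi k%:R = eps ^+ k.
Proof.
rewrite /chi val_Zp_nat ?(prim_expr_mod eps_l) //; lia.
Qed.

Lemma chiD a b : chi (a + b) = chi a * chi b.
Proof. by rewrite -(natr_Zp a) -(natr_Zp b) -natrD !chi_nat exprD. Qed.

Lemma chi0 : chi 0 = 1.
Proof. by rewrite (chi_nat 0). Qed.

Lemma chiN a : chi (- a) = (chi a)^-1.
Proof.
apply: (mulIf (x := chi a)); last first.
  rewrite -chiD addNr chi0 mulVf //.
all: apply: contra_eq_neq chi0 => ca.
all: by rewrite -(subrr a) chiD ca mul0r eq_sym oner_eq0.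
Qed.

Lemma chi_eq1 a : chi a = 1 -> a = 0.
Proof.
move/eqP; rewrite -(prim_order_dvd eps_l) => la; apply/val_inj => /=.
have := ltn_ord a; rewrite [X in (_ < X)%N]Zp_cast; last by lia.
by move=> al; apply/eqP; rewrite -leqn0 leqNgt; apply: contraL la => a0; rewrite gtnNdvd.
Qed.

Lemma two_neq0 : 2%:R != 0 :> 'Z_l.
Proof.
apply/eqP => /(congr1 (@nat_of_ord _)); rewrite val_Zp_nat ?modn_small //; lia.
Qed.

Lemma double_eq0 (a : 'Z_l) : a + a = 0 -> a = 0.
Proof.
move=> aa; apply: chi_eq1; rewrite /chi; apply/eqP; rewrite -(prim_order_dvd eps_l).
have /eqP := chi0; rewrite -aa chiD /chi -exprD -(prim_order_dvd eps_l) addnn -mul2n.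
by rewrite Gauss_dvdr // coprime_sym coprime2n.
Qed.

(** The number by which {h}_q acts on u(m) when h acts by chi a; it is the
    q-integer [a] when q = eps, and [a/2] to base q when q = eps^2. *)
Definition qint (q : K) (a : 'Z_l) : K := (q - q^-1)^-1 * (chi a - chi (- a)).

Lemma qint0 q : qint q 0 = 0.
Proof. by rewrite /qint oppr0 subrr mulr0. Qed.

(** A zero means eps^(2a) = 1, hence a = 0 because l is odd.  The case
    q = q^-1, where the denominator vanishes, would mean eps^(2k) = 1. *)
Lemma qint_eq0 k a : k \in [:: 1; 2]%N -> qint (eps ^+ k) a = 0 -> a = 0.
Proof.
move=> hk /eqP; rewrite mulf_eq0 invr_eq0 => H.
apply: double_eq0; apply: chi_eq1; rewrite chiD.
have aux b : chi b = chi (- b) -> chi b * chi b = 1.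
  by move=> cb; rewrite {2}cb -chiD subrr chi0.
case/orP: H; rewrite subr_eq0 => /eqP; last exact: aux.
rewrite -(chi_nat k) -chiN => /aux; rewrite -chiD => /chi_eq1/double_eq0.
by move=> k0; move: hk; rewrite !inE => /orP[] /eqP kE; move: two_neq0 k0;
   rewrite kE ?oner_eq0 => // h /eqP; rewrite ?oner_eq0 // (negPf h).
Qed.

(** * Entries of index matrices, with indices starting at 1 *)

Definition entry (m : M) (i j : nat) : 'Z_l := at1 0 (fun a => at1 0 (m a) j) i.

Definition in_range (i : nat) := (0 < i <= n)%N.

Lemma entry_ord (m : M) (a b : 'I_n) : entry m a.+1 b.+1 = m a b.
Proof. by rewrite /entry /at1 /= !valK. Qed.

Lemma in_range_ind (P : nat -> Prop) : (forall a : 'I_n, P a.+1) ->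
  forall i, in_range i -> P i.
Proof. by move=> Pa [//|i] /= ni; exact: (Pa (Ordinal ni)). Qed.

Lemma entryD m m' i j : entry (m + m') i j = entry m i j + entry m' i j.
Proof.
rewrite /entry /at1; case: (insub i.-1) => [a|] /=; last by rewrite addr0.
by case: (insub j.-1) => [b|] /=; rewrite ?mxE ?addr0.
Qed.

Lemma entry0 i j : entry 0 i j = 0.
Proof.
rewrite /entry /at1; case: (insub i.-1) => [a|] //=.
by case: (insub j.-1) => [b|] //=; rewrite mxE.
Qed.

Lemma entryN m i j : entry (- m) i j = - entry m i j.
Proof. by apply/eqP; rewrite -addr_eq0 -entryD addNr entry0. Qed.

Lemma entry_munit i j a b : in_range a -> in_range b ->
  entry (munit l n i j) a b = ((a == i) && (b == j))%:R.
Proof.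
move: a; apply: in_range_ind => a; move: b; apply: in_range_ind => b.
by rewrite entry_ord mxE.
Qed.

(** * Diagonal operators and shifts *)

Definition diagop (L : M -> 'Z_l) : 'End(V) := linext (fun m => chi (L m) *: ubasis K m).

(** The sign is such that the coefficient of [shiftop s v] at m is the
    coefficient of v at m + s: coefficients are read at the source. *)
Definition shiftop (s : M) : 'End(V) := linext (fun m => ubasis K ((m : M) - s)).

Lemma linext_diagE (w : M -> K) (v : V) m :
  linext (fun m' => w m' *: ubasis K m') v m = w m * v m.
Proof.
rewrite lfunE /= /linext_fun sum_ffunE (bigD1 m) //= big1 ?addr0.
  by rewrite !ffunE eqxx /GRing.scale /= mulr1 mulrC.
by move=> m' /negPf mm'; rewrite !ffunE eq_sym mm' !scaler0.
Qed.

Lemma diagopE L v m : diagop L v m = chi (L m) * v m.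
Proof. exact: linext_diagE. Qed.

Lemma shiftopE s v m : shiftop s v m = v (m + s).
Proof.
rewrite lfunE /= /linext_fun sum_ffunE (bigD1 (m + s)) //= big1 ?addr0.
  by rewrite !ffunE addrK eqxx /GRing.scale /= mulr1.
by move=> m' /negPf mm'; rewrite !ffunE eq_sym subr_eq mm' scaler0.
Qed.

Lemma diagop_comp L L' : (diagop L \o diagop L')%VF = diagop (fun m => L m + L' m).
Proof. by apply/lfunP => v; apply/ffunP => m; rewrite comp_lfunE !diagopE chiD mulrA. Qed.

Lemma diagop_id L : (forall m, L m = 0) -> diagop L = \1%VF.
Proof.
by move=> L0; apply/lfunP => v; apply/ffunP => m; rewrite id_lfunE diagopE L0 chi0 mul1r.
Qed.

Lemma diagop_inv L : ((diagop L)^-1)%VF = diagop (fun m => - L m).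
Proof.
by apply: lfun_inv_unique; rewrite diagop_comp diagop_id // => m; rewrite ?addNr ?subrr.
Qed.

Lemma shiftop_comp s s' : (shiftop s \o shiftop s')%VF = shiftop (s + s').
Proof. by apply/lfunP => v; apply/ffunP => m; rewrite comp_lfunE !shiftopE addrA. Qed.

Lemma shiftop0 : shiftop 0 = \1%VF.
Proof. by apply/lfunP => v; apply/ffunP => m; rewrite id_lfunE shiftopE addr0. Qed.

Lemma shiftop_inv s : ((shiftop s)^-1)%VF = shiftop (- s).
Proof. by apply: lfun_inv_unique; rewrite shiftop_comp ?addNr ?subrr shiftop0. Qed.

Lemma lpow_shiftop s k : lpow (shiftop s) k = shiftop (s *~ k).
Proof.
have aux t p : iter p (comp_lfun (shiftop t)) \1%VF = shiftop (t *+ p).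
  by elim: p => [|p IH]; rewrite ?mulr0n ?shiftop0 // iterS IH shiftop_comp mulrS.
by case: k => p; rewrite /lpow ?shiftop_inv aux // NegzE mulrNz mulNrn.
Qed.

Lemma lpow_diagop L k : lpow (diagop L) k = diagop (fun m => L m *~ k).
Proof.
have aux L' p : iter p (comp_lfun (diagop L')) \1%VF = diagop (fun m => L' m *+ p).
  elim: p => [|p IH]; first by rewrite [RHS]diagop_id // => m; rewrite mulr0n.
  rewrite iterS IH diagop_comp; apply/lfunP => v; apply/ffunP => m.
  by rewrite !diagopE mulrS.
case: k => p; rewrite /lpow ?diagop_inv aux //.
by apply/lfunP => v; apply/ffunP => m; rewrite !diagopE NegzE mulrNz mulNrn.
Qed.

Lemma xop_shiftop i j : xop K l n i j = shiftop (munit l n i j).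
Proof. by []. Qed.

Lemma zop_diagop i j : zop l n eps i j = diagop (fun m => entry m i j + (bexp n i j)%:R).
Proof.
apply/lfunP => v; apply/ffunP => m.
rewrite diagopE linext_diagE chiD chi_nat exprD; congr (_ * _ * _).
Qed.

Lemma qbraceE q L v m : qbrace q (diagop L) v m = qint q (L m) * v m.
Proof.
rewrite /qbrace diagop_inv scale_lfunE !ffunE add_lfunE opp_lfunE !ffunE.
by rewrite !diagopE -mulrBl /qint -mulrA.
Qed.

(** * The operators F, C and D as sums of weighted shifts *)

Local Notation "'e_ i j" := (munit l n i j) (at level 10, i, j at level 8).

(** Exponents such as (-2)%Z are literal constructors of int, not opposites,
    so the usual lemmas on negative multiples do not see them. *)
Lemma mulz_Negz (U : zmodType) (x : U) k : x *~ Negz k = - (x *+ k.+1).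
Proof. by []. Qed.

Lemma mulz_Posz (U : zmodType) (x : U) k : x *~ Posz k = x *+ k.
Proof. by []. Qed.

Lemma bexp_row k j : (0 < k < j)%N -> bexp n k j = (bexp n k j.-1).+1.
Proof. by rewrite /bexp => kj; rewrite !ifT; lia. Qed.

Lemma bexp_col k j : (k < j < n)%N -> bexp n j k = (bexp n j.+1 k).+1.
Proof. by rewrite /bexp => kj; rewrite !ifF; lia. Qed.

Lemma bexp_corner k : (0 < k < n)%N -> bexp n n k = (bexp n k n).+1.
Proof. by rewrite /bexp => kj; rewrite ifF ?ifT; lia. Qed.

(** The symmetrizer d_j of the Cartan matrix, half the squared length of
    alpha_j. *)
Definition root_len (j : nat) : nat := if j == n then 2 else 1.

(** The weights are functions of the source index m of the term; for j = n the
    base eps^2 comes with a doubled exponent, except in the middle term of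
    C_{k,n}. *)
Definition wtF j (m : M) : K :=
  qint (eps ^+ root_len j) (- (entry m j j *+ root_len j)).

Lemma opF_shift j v m : in_range j ->
  opF l n eps j v m = wtF j (m + 'e_ j j) * v (m + 'e_ j j).
Proof.
move=> rj; have bjj i : bexp n i i = 1%N by rewrite /bexp leqnn; lia.
rewrite /opF /wtF /root_len; case: eqP => [jn|_].
all: rewrite !zop_diagop // lpow_diagop // xop_shiftop comp_lfunE qbraceE // shiftopE.
  rewrite jn in rj *.
all: congr (qint _ _ * _); rewrite bjj entryD entry_munit // !eqxx /= mulz_Negz; ring.
Qed.

Definition wtC1 k j (m : M) : K :=
  qint (eps ^+ root_len j) ((entry m k j.-1 - entry m k j) *+ root_len j).

Definition wtC2 k j (m : M) : K :=
  if j == n then qint eps (entry m k n.-1 - entry m n k)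
  else qint eps (entry m j.+1 k - entry m j k).

Definition wtC3 k (m : M) : K :=
  qint (eps ^+ 2) ((entry m k n - entry m n k) *+ 2).

(** The constants b_{i,j} decrease by one along each step from (j,k) to
    (j+1,k) and increase by one from (k,j-1) to (k,j), which offsets what the
    shifts by x contribute to the exponents. *)
Lemma opC_short_shift k j v m : (0 < k < j)%N -> (j < n)%N ->
  let s := 'e_ k j + 'e_ j k - 'e_ k j.-1 in
  opC l n eps k j v m = wtC1 k j (m + 'e_ k j) * v (m + 'e_ k j) +
                        wtC2 k j (m + s) * v (m + s).
Proof.
move=> kj jn s; rewrite /opC /wtC1 /wtC2 /root_len (ltn_eqF jn).
rewrite !zop_diagop // !lpow_diagop // !diagop_comp // !xop_shiftop lpow_shiftop.
rewrite add_lfunE !ffunE !comp_lfunE !qbraceE // !shiftopE.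
have sE : m + 'e_ k j + 'e_ j k + 'e_ k j.-1 *~ (-1)%Z = m + s.
  by rewrite mulz_Negz /s !addrA.
have rk : in_range k by rewrite /in_range; lia.
have rj : in_range j by rewrite /in_range; lia.
have rj' : in_range j.-1 by rewrite /in_range; lia.
have rj1 : in_range j.+1 by rewrite /in_range; lia.
have E1 : (j.-1 == j) = false by lia.
have E2 : (k == j) = false by lia.
have E2' : (j == k) = false by lia.
have E3 : (j == j.-1) = false by lia.
have E4 : (j.+1 == j) = false by lia.
have E5 : (j.+1 == k) = false by lia.
have E6 : (j == j.+1) = false by lia.
rewrite sE expr1 mulr1n; congr (_ * _ + _ * _); congr (qint _ _).
  rewrite (bexp_row kj) entryD entryD !entry_munit // E1 !eqxx /=.
  rewrite -natr1 mulz_Negz; ring.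
rewrite bexp_col ?[LHS]/= ?/s; last by lia.
rewrite !(entryD, entryN) !entry_munit // !eqxx ?(E1, E2, E2', E3, E4, E5, E6) /= -natr1 mulz_Negz; ring.
Qed.

Lemma opC_long_shift k v m : (0 < k < n)%N ->
  let s := 'e_ k n + 'e_ n k - 'e_ k n.-1 in
  let s' := 'e_ k n + 'e_ n k *+ 2 - 'e_ k n.-1 *+ 2 in
  opC l n eps k n v m = wtC1 k n (m + 'e_ k n) * v (m + 'e_ k n) +
                        wtC2 k n (m + s) * v (m + s) +
                        wtC3 k (m + s') * v (m + s').
Proof.
move=> kn s s'; rewrite /opC /wtC1 /wtC2 /wtC3 /root_len eqxx.
rewrite !zop_diagop // !lpow_diagop // !diagop_comp // !xop_shiftop !lpow_shiftop.
rewrite !add_lfunE !ffunE !comp_lfunE !qbraceE // !shiftopE.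
have sE : m + 'e_ k n.-1 *~ (-1)%Z + 'e_ k n + 'e_ n k = m + s.
  by rewrite mulz_Negz -!addrA; congr (_ + _); rewrite addrC.
have sE' : m + 'e_ k n.-1 *~ (-2)%Z + 'e_ k n + 'e_ n k *~ 2 = m + s'.
  by rewrite mulz_Negz -!addrA; congr (_ + _); rewrite addrC.
have rk : in_range k by rewrite /in_range; lia.
have rn : in_range n by rewrite /in_range; lia.
have rn' : in_range n.-1 by rewrite /in_range; lia.
have E1 : (n.-1 == n) = false by lia.
have E1' : (n == n.-1) = false by lia.
have E2 : (k == n) = false by lia.
have E2' : (n == k) = false by lia.
rewrite sE sE' [LHS]addrC [X in _ + X]addrC addrA.
rewrite bexp_corner // (bexp_row kn).
congr (_ * _ + _ * _ + _ * _); congr (qint _ _).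
all: rewrite /s /s' !(entryD, entryN, mulrS, mulr0n) !entry_munit // !eqxx ?(E1, E2, E2', E1') /=.
all: rewrite -!natr1 ?(mulz_Negz, mulz_Posz); ring.
Qed.

Definition shiftD k j : M :=
  if j == n then 'e_ n k *+ 2 - 'e_ k n.-1 *+ 2
  else 'e_ k j + 'e_ j k - 'e_ k j.-1 - 'e_ j.+1 k.

Lemma opD_shift k j v m : opD K l n k j v m = v (m + shiftD k j).
Proof.
rewrite /opD /shiftD; case: eqP => _; rewrite !xop_shiftop !lpow_shiftop !comp_lfunE !shiftopE.
  by rewrite mulz_Negz -addrA [X in m + X]addrC.
rewrite !mulz_Negz -!addrA; congr (v (m + _)).
by rewrite addrCA; congr (_ + _); rewrite addrA addrC.
Qed.

Ltac range_lia := unfold in_range in *;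
  repeat match goal with H : context [@entry] |- _ => clear H end; lia.

Ltac entry_simp :=
  rewrite ?(entryD, entryN, mulr2n, mulr1n);
  rewrite ?entry_munit; [|range_lia..];
  repeat match goal with |- context [@eq_op Datatypes_nat__canonical__eqtype_Equality ?a ?b] =>
    first [have -> : (a == b) = true by range_lia | have -> : (a == b) = false by range_lia] end;
  rewrite ?andbF ?andbT ?(mulr1n, mulr0n, subr0, addr0, add0r).

(** * The recursion on rows and columns *)

(** The operator e_j with all factors and summands of index below k omitted. *)
Definition e_from k j : 'End(V) :=
  (lprod k j (fun p => opD K l n p j) \o opF l n eps j)%VF +
  \sum_(k <= q < j) (lprod k q (fun p => opD K l n p j) \o opC l n eps q j)%VF.

Lemma lprod_nil (W : vectType K) k (F : nat -> 'End(W)) : lprod k k F = \1%VF.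
Proof. by rewrite /lprod big_geq. Qed.

Lemma e_from_diag j : e_from j j = opF l n eps j.
Proof. by rewrite /e_from lprod_nil comp_lfun1l big_geq ?addr0. Qed.

Lemma e_from_rec k j : (k < j)%N ->
  e_from k j = opC l n eps k j + (opD K l n k j \o e_from k.+1 j)%VF.
Proof.
have lprod_ltn q F : (k < q)%N ->
    @lprod K V k q F = (F k \o lprod k.+1 q F)%VF.
  by move=> kq; rewrite /lprod big_ltn.
move=> kj; rewrite /e_from big_ltn // lprod_nil comp_lfun1l addrCA; congr (_ + _).
rewrite comp_lfunDr lprod_ltn // comp_lfunA; congr (_ + _).
apply/lfunP => v; rewrite comp_lfunE !sum_lfunE linear_sum big_nat [RHS]big_nat.
by apply: eq_bigr => q /andP[kq _]; rewrite lprod_ltn // !comp_lfunE.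
Qed.

Lemma e_fromE k j v m : (k < j)%N ->
  e_from k j v m = opC l n eps k j v m + e_from k.+1 j v (m + shiftD k j).
Proof.
by move=> kj; rewrite e_from_rec // add_lfunE ffunE comp_lfunE opD_shift.
Qed.

(** * Supports *)

Definition confined i j (c : 'Z_l) (v : V) := forall m : M, entry m i j != c -> v m = 0.

Lemma confinedP i j c (v : V) m : confined i j c v -> v m != 0 -> entry m i j = c.
Proof. by move=> vc; apply: contraNeq => /vc ->. Qed.

(** No factor of e_j^(k) shifts an entry in a row or a column of index below k,
    so the entry (a, b) is a grading that e_j^(k) respects. *)
Lemma e_from_confined k j a b c v : (0 < k <= j)%N -> (j <= n)%N ->
  in_range a -> in_range b -> (a < k)%N || (b < k)%N ->
  confined a b c v -> confined a b c (e_from k j v).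
Proof.
move=> kj jn ra rb; have [d dE] : exists d, d = (j - k)%N by exists (j - k)%N.
elim: d k kj dE => [|d IH] k kj dE abk vc m mc.
  have -> : k = j by range_lia.
  rewrite e_from_diag opF_shift //; last by range_lia.
  rewrite vc ?mulr0 // entryD entry_munit //.
  have -> : ((a == j) && (b == j)) = false by range_lia.
  by rewrite addr0.
have e0 p q : (k <= p)%N -> (k <= q)%N -> entry ('e_ p q) a b = 0.
  move=> kp kq; rewrite entry_munit //.
  by rewrite (_ : (a == p) && (b == q) = false) //; range_lia.
have v0 s : entry s a b = 0 -> v (m + s) = 0.
  by move=> s0; rewrite vc // entryD s0 addr0.
rewrite e_fromE; last by range_lia.
rewrite (IH k.+1) ?addr0; [|range_lia|range_lia|range_lia|by []|]; last first.
  rewrite entryD /shiftD; case: ifP => _; rewrite !(entryD, entryN, mulr2n) !e0; try range_lia.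
    by rewrite !(addr0, oppr0).
  by rewrite !(addr0, oppr0).
have [jn'|jn'] := ltnP j n.
  rewrite opC_short_shift; [|range_lia|range_lia].
  by rewrite !v0 ?mulr0 ?addr0 // ?(entryD, entryN) !e0 ?(addr0, oppr0) //; range_lia.
have -> : j = n by range_lia.
rewrite opC_long_shift; [|range_lia].
by rewrite !v0 ?mulr0 ?addr0 // ?(entryD, entryN, mulr2n) !e0 ?(addr0, oppr0) //; range_lia.
Qed.

Lemma mulrn_root_len_eq0 j (a : 'Z_l) : a *+ root_len j = 0 -> a = 0.
Proof.
rewrite /root_len; case: (j == n); last by rewrite mulr1n.
by rewrite mulr2n => /double_eq0.
Qed.

Lemma root_len_mem j : root_len j \in [:: 1; 2]%N.
Proof. by rewrite /root_len; case: (j == n). Qed.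

Lemma wtF_eq0 j (m : M) : wtF j m = 0 -> entry m j j = 0.
Proof.
move/(qint_eq0 (root_len_mem j))/eqP.
by rewrite oppr_eq0 => /eqP/mulrn_root_len_eq0.
Qed.

Lemma wtC1_eq0 k j (m : M) : wtC1 k j m = 0 -> entry m k j.-1 = entry m k j.
Proof.
move/(qint_eq0 (root_len_mem j))/mulrn_root_len_eq0/eqP.
by rewrite subr_eq0 => /eqP.
Qed.

Lemma wtC2_eq0 k j (m : M) : wtC2 k j m = 0 ->
  if j == n then entry m k n.-1 = entry m n k else entry m j.+1 k = entry m j k.
Proof.
have aux a : qint eps a = 0 -> a = 0 by apply: (@qint_eq0 1).
by rewrite /wtC2; case: ifP => _ /aux/eqP; rewrite subr_eq0 => /eqP.
Qed.

(** Each weight of C_{k,j} is the q-integer of a difference of two of the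
    entries that are 0 on the support of v. *)
Lemma opC_eq0 k j v : (0 < k < j)%N -> (j <= n)%N ->
  confined k j.-1 0 v -> confined k j 0 v -> confined j k 0 v ->
  ((j < n)%N -> confined j.+1 k 0 v) -> opC l n eps k j v = 0.
Proof.
move=> kj jn c1 c2 c3 c4; apply/ffunP => m; rewrite [RHS]ffunE.
have w0 (w : M -> K) s : (v (m + s) != 0 -> w (m + s) = 0) -> w (m + s) * v (m + s) = 0.
  by have [->|_ ->] := eqVneq (v (m + s)) 0; rewrite ?mulr0 ?mul0r.
have [jn'|jn'] := ltnP j n.
  rewrite opC_short_shift // !w0 ?addr0 // => v0.
    by rewrite /wtC2 (ltn_eqF jn') (confinedP (c4 jn') v0) (confinedP c3 v0) subrr qint0.
  by rewrite /wtC1 (confinedP c1 v0) (confinedP c2 v0) subrr mul0rn qint0.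
have jE : j = n by range_lia.
rewrite jE in kj c1 c2 c3 *; rewrite opC_long_shift // !w0 ?addr0 // => v0.
- by rewrite /wtC3 (confinedP c2 v0) (confinedP c3 v0) subrr mul0rn qint0.
- by rewrite /wtC2 eqxx (confinedP c1 v0) (confinedP c3 v0) subrr qint0.
- by rewrite /wtC1 (confinedP c1 v0) (confinedP c2 v0) subrr mul0rn qint0.
Qed.

(** The displacements that separate terms are 1, -1 and -2, all nonzero in
    'Z_l. *)
Ltac small_neq0 :=
  match goal with |- is_true (?x != 0) =>
    first [ have -> : x = 1 by ring
          | have -> : x = - 1 by ring
          | have -> : x = - 2%:R by ring ] end;
  rewrite ?oppr_eq0 ?oner_eq0 ?two_neq0 //.

Lemma e_from_ubasis0 k j : (0 < k <= j)%N -> (j <= n)%N -> e_from k j (ubasis K (0 : M)) = 0.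
Proof.
have c0 a b : confined a b 0 (ubasis K (0 : M)).
  by move=> m; rewrite ffunE; case: (m =P 0) => // ->; rewrite entry0 eqxx.
move=> kj jn; have [d dE] : exists d, d = (j - k)%N by exists (j - k)%N.
elim: d k kj dE => [|d IH] k kj dE.
  have -> : k = j by range_lia.
  apply/ffunP => m; rewrite e_from_diag opF_shift ?[RHS]ffunE //; last by range_lia.
  have [->|] := eqVneq (m + 'e_ j j) 0; first by rewrite /wtF entry0 mul0rn oppr0 qint0 mul0r.
  by move=> /negPf h; rewrite ffunE h mulr0.
rewrite e_from_rec; last by range_lia.
rewrite add_lfunE comp_lfunE IH ?linear0 ?addr0; [|range_lia..].
by apply: opC_eq0 => //; range_lia.
Qed.

(** * Emptying row k and column k *)

Section Step.
Variables (k : nat) (u : V).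
Hypotheses (rk : in_range k)
  (e_from_u : forall j, (k <= j <= n)%N -> e_from k j u = 0).

Let e_splits j m : (k < j <= n)%N ->
  opC l n eps k j u m + e_from k.+1 j u (m + shiftD k j) = 0.
Proof.
by move=> kj; rewrite -e_fromE ?e_from_u ?ffunE //; range_lia.
Qed.

(** The equation e_j^(k) u = 0 is read at m - eps_{k,j}, where the first term
    of C_{k,j} sees the coefficient of u at m; all other terms see coefficients
    at indices whose entry (k, j-1) is nonzero. *)
Lemma row_confined j : (k <= j <= n)%N -> confined k j 0 u.
Proof.
have [d dE] : exists d, d = (j - k)%N by exists (j - k)%N.
elim: d j dE => [|d IH] j dE kj m; apply: contraNeq => um.
  have jk : j = k by range_lia.
  rewrite jk in kj *.
  have /(congr1 (fun v : V => v (m - 'e_ k k))) := e_from_u kj.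
  rewrite e_from_diag opF_shift // ffunE subrK => /eqP.
  by rewrite mulf_eq0 (negPf um) orbF => /eqP/wtF_eq0/eqP.
have c1 : confined k j.-1 0 u by apply: IH; range_lia.
have m0 := confinedP c1 um.
have /andP[k_gt0 k_le] := rk.
have u0 s : entry s k j.-1 != 0 -> u (m - 'e_ k j + s) = 0.
  by move=> s0; apply: c1; entry_simp; rewrite m0 add0r.
have later0 : e_from k.+1 j u (m - 'e_ k j + shiftD k j) = 0.
  apply: (e_from_confined (a := k) (b := j.-1) (c := 0)) => //; try range_lia.
  rewrite /shiftD; case: ifP => jn; entry_simp; rewrite m0; small_neq0.
have := @e_splits j (m - 'e_ k j); rewrite later0 addr0 => /(_ ltac:(range_lia)).
have [jn|jn] := ltnP j n.
  rewrite opC_short_shift; [|range_lia|range_lia].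
  rewrite subrK [X in _ + _ * X]u0 ?mulr0 ?addr0.
    move/eqP; rewrite mulf_eq0 (negPf um) orbF => /eqP/wtC1_eq0 <-.
    by rewrite m0.
  by entry_simp; small_neq0.
have jE : j = n by range_lia.
rewrite jE in um m0 u0 *; rewrite opC_long_shift; [|range_lia].
rewrite subrK [X in _ + _ * X + _]u0 ?[X in _ + _ * X]u0 ?mulr0 ?addr0; try by entry_simp; small_neq0.
move/eqP; rewrite mulf_eq0 (negPf um) orbF => /eqP/wtC1_eq0 <-.
by rewrite m0.
Qed.

(** Downward induction on j.  The equation is now read at m - s, where s is
    the shift of the second term of C_{k,j}, so that this term sees the
    coefficient of u at m. *)
Lemma col_confined j : (k < j <= n)%N ->
  confined j k 0 u /\ e_from k.+1 j u = 0.
Proof.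
have [d dE] : exists d, d = (n - j)%N by exists (n - j)%N.
have /andP[k_gt0 k_le] := rk.
have row i : (k <= i <= n)%N -> confined k i 0 u by exact: row_confined.
elim: d j dE => [|d IH] j dE kj.
  have jE : j = n by range_lia.
  rewrite jE in kj *.
  (* The entry (k, n-1) is 0 on the support, and it is 1 or -1 at the indices
     whose coefficients enter the other terms of the equation. *)
  have cn : confined n k 0 u.
    move=> m; apply: contraNeq => um.
    have m0 i (ki : (k <= i <= n)%N) : entry m k i = 0 := confinedP (row i ki) um.
    have m1 : entry m k n.-1 = 0 by apply: m0; range_lia.
    have u0 s : entry s k n.-1 != 0 -> u (m + s) = 0.
      by move=> s0; apply: (row n.-1); [range_lia | rewrite entryD m1 add0r].
    set s := 'e_ k n + 'e_ n k - 'e_ k n.-1.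
    have later0 : e_from k.+1 n u (m - s + shiftD k n) = 0.
      apply: (e_from_confined (a := k) (b := n.-1) (c := 0)) => //; try range_lia.
        by apply: row; range_lia.
      by rewrite /shiftD eqxx /s; entry_simp; rewrite m1; small_neq0.
    have := @e_splits n (m - s) kj; rewrite later0 addr0 opC_long_shift; last by range_lia.
    rewrite -/s subrK -!addrA [X in _ * X + _]u0; last by rewrite /s; entry_simp; small_neq0.
    rewrite [X in _ + (_ + _ * X)]u0; last by rewrite /s; entry_simp; small_neq0.
    rewrite !mulr0 addr0 add0r => /eqP; rewrite mulf_eq0 (negPf um) orbF => /eqP/wtC2_eq0.
    by rewrite eqxx m1 => <-.
  split=> //; apply/ffunP => m; rewrite ffunE.
  have := @e_splits n (m - shiftD k n) kj; rewrite subrK opC_eq0 ?ffunE ?add0r //; try range_lia.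
  - by apply: row; range_lia.
  - by apply: row; range_lia.
have [||cj1 _] := IH j.+1; [range_lia|range_lia|].
have crow : confined k j 0 u by apply: row; range_lia.
have crow' : confined k j.-1 0 u by apply: row; range_lia.
(* The second term of C_{k,j} is now separated from D_{k,j} e_j^(k+1) by the
   entry (j+1, k), which D_{k,j} alone moves. *)
have cj : confined j k 0 u.
  move=> m; apply: contraNeq => um.
  have m0 := confinedP crow um.
  have m1 := confinedP crow' um.
  have m2 := confinedP cj1 um.
  set s := 'e_ k j + 'e_ j k - 'e_ k j.-1.
  have later0 : e_from k.+1 j u (m - s + shiftD k j) = 0.
    apply: (e_from_confined (a := j.+1) (b := k) (c := 0)) => //; try range_lia.
    rewrite /shiftD ifF ?/s; last by range_lia.
    by entry_simp; rewrite m2; small_neq0.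
  have := @e_splits j (m - s); rewrite later0 addr0 => /(_ ltac:(range_lia)).
  rewrite opC_short_shift; [|range_lia|range_lia].
  rewrite -/s subrK.
  rewrite (_ : wtC1 _ _ _ * _ = 0) ?add0r.
    move/eqP; rewrite mulf_eq0 (negPf um) orbF => /eqP/wtC2_eq0.
    have -> : (j == n) = false by range_lia.
    by rewrite m2 => <-.
  rewrite [X in _ * X]crow' ?mulr0 // /s; entry_simp.
  by rewrite m1; small_neq0.
(* All of C_{k,j} kills u; the shift D_{k,j} is undone by the choice of the
   coefficient. *)
split=> //; apply/ffunP => m; rewrite ffunE.
by have := @e_splits j (m - shiftD k j) ltac:(range_lia); rewrite subrK opC_eq0 ?ffunE ?add0r //; range_lia.
Qed.
End Step.

(** * The joint kernel *)

Lemma lines_confined u : (forall j, in_range j -> op_e l n eps j u = 0) ->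
  forall k, (0 < k <= n.+1)%N ->
  (forall a b, in_range a -> in_range b -> (a < k)%N || (b < k)%N -> confined a b 0 u) /\
  (forall j, (k <= j <= n)%N -> e_from k j u = 0).
Proof.
move=> eu; elim=> // k IH /andP[_ kn].
(* At k = 1 there are no rows and columns yet, and e_j^(1) is e_j. *)
have [k0|k0] := posnP k.
  rewrite k0; split=> [a b|j /eu //]; rewrite /in_range; lia.
have [|ck ek] := IH; first by rewrite k0 ltnW.
have rk : in_range k by rewrite /in_range k0.
split=> [a b ra rb abk|j kj]; last by case: (col_confined rk ek kj).
have [abk'|] := boolP ((a < k)%N || (b < k)%N); first exact: ck.
have [->|ak] := eqVneq a k => nabk; first by apply: (row_confined rk ek); range_lia.
have -> : b = k by range_lia.
by case: (@col_confined k u rk ek a); first range_lia.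
Qed.

Lemma op_e_kernel (u : V) :
  (forall j, in_range j -> op_e l n eps j u = 0) <->
  exists c : K, u = c *: ubasis K (0 : M).
Proof.
split=> [eu|[c ->] j]; last first.
  by move=> rj; rewrite linearZ /= [X in _ *: X](@e_from_ubasis0 1 j) ?scaler0 //; range_lia.
have [|cu _] := lines_confined eu (k := n.+1); first by rewrite leqnn.
exists (u 0); apply/ffunP => m; rewrite !ffunE.
have [->|/negPf m0] := eqVneq m 0; first by rewrite /GRing.scale /= mulr1.
rewrite scaler0; apply/eqP/negPn/negP => um; case/negP: m0; apply/eqP.
apply/matrixP => a b; rewrite mxE -entry_ord.
have rord (i : 'I_n) : in_range i.+1 by rewrite /in_range /=.
by apply: (confinedP (cu _ _ _ _ _) um) => //=; rewrite ltnS ltn_ord.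
Qed.
End Kernel.

Theorem proposition3p7 (R : realType) (l : nat) (hl : (3 < l)%N)
    (hodd : odd l) (eps : R[i]) (heps : l.-primitive_root eps)
    (logeps : R[i]) (hlog : cexp logeps = eps)
    (n : nat) (hn : (2 <= n)%N) (lam : 'rV[R[i]]_n)
    (u : Vspace R[i] l n) :
  (forall i : 'I_n, schnizer l eps logeps lam (Ue i) u = 0)
    <-> exists c : R[i], u = c *: ubasis R[i] (0 : 'M['Z_l]_n).
Proof.
rewrite -(op_e_kernel hl hodd heps); split=> [eu|eu i]; last by apply: eu; rewrite /in_range /=.
exact: in_range_ind.
Qed.
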